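(* Let $B^{c},B^{d}\in\mathbb{R}^{n\times n}$ be adjacency matrices (zero diagonal) such that the signed digraphs $\mathscr{G}(B^{c})$ and $\mathscr{G}(B^{d})$ are sign-inconsistent, and suppose that the union $\mathscr{G}(B^{c})\cup\mathscr{G}(B^{d})$ is strongly connected. Let $\delta>1$ be arbitrary, let $$\zeta=\frac{\lambda_{\max}(H)\,\lambda_{\max}\!\left((L_{B^{c}}+\delta L_{B^{d}})(L_{B^{c}}+\delta L_{B^{d}})^{\mathrm{T}}\right)}{2(\delta-1)},$$ where $H\in\mathbb{R}^{n\times n}$ is the unique positive definite matrix satisfying $(L_{B^{c}}+L_{B^{d}})^{\mathrm{T}}H+H(L_{B^{c}}+L_{B^{d}})=I$, and let $k>\zeta$. Then the system $$\begin{bmatrix}\dot{x}(t)\\ \dot{y}(t)\end{bmatrix}=\begin{bmatrix}-L_{B^{c}}&I\\ -kL_{B^{d}}&-kI\end{bmatrix}\begin{bmatrix}x(t)\\ y(t)\end{bmatrix}$$ achieves neutralization: for any $x(0)\in\mathbb{R}^{n}$ and $y(0)\in\mathbb{R}^{n}$, $\lim_{t\to\infty}x(t)=0$ and $\lim_{t\to\infty}y(t)=0$.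
   Context: An adjacency matrix is a real matrix $B=[b_{ij}]\in\mathbb{R}^{n\times n}$ with $b_{ii}=0$ for all $i$. The signed digraph $\mathscr{G}(B)$ has vertices $v_1,\dots,v_n$ and an arc $(v_j,v_i)$ (from $v_j$ to $v_i$) iff $b_{ij}\neq0$. The Laplacian matrix is $L_B=[l^B_{ij}]$ with $l^B_{ii}=\sum_{k\ne i}|b_{ik}|$ and $l^B_{ij}=-b_{ij}$ for $j\neq i$. $\mathscr{G}(B^c)$ and $\mathscr{G}(B^d)$, with $B^c=[b^c_{ij}]$, $B^d=[b^d_{ij}]$, are sign-consistent if $b^c_{ij}b^d_{ij}\ge0$ for all $i,j$, and sign-inconsistent otherwise (i.e. $b^c_{ij}b^d_{ij}<0$ for some $i,j$). The union $\mathscr{G}(B^c)\cup\mathscr{G}(B^d)$ is the digraph on the same vertices whose arc set is the union of the two arc sets; it is strongly connected if for each pair of distinct vertices there is a directed path from each to the other. $\lambda_{\max}$ denotes the largest eigenvalue of a matrix with real eigenvalues. (Under the stated assumptions the matrix $H$ exists, is unique, and $\zeta>0$.) *)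

(* Defs.v *)
From HB Require Import structures.
From mathcomp Require Export all_boot all_order all_algebra.
From mathcomp Require Export all_classical all_reals all_analysis.
Export Order.TTheory GRing.Theory Num.Theory.
Export numFieldNormedType.Exports.

Set Implicit Arguments.
Unset Strict Implicit.
Unset Printing Implicit Defensive.

#[export] Set Implicit Arguments.
#[export] Unset Strict Implicit.
#[export] Unset Printing Implicit Defensive.

#[global] Open Scope classical_set_scope.
#[global] Open Scope ring_scope.

Section SignedDigraphs.
Variables (R : realType) (n : nat).
Implicit Types B : 'M[R]_n.

Definition adjacency_matrix B : Prop := forall i, B i i = 0.

(* [arc B j i] is the arc from v_j to v_i; the entry governing it is b_ij. *)
Definition arc B : rel 'I_n := fun j i => B i j != 0.

Definition union_arc B1 B2 : rel 'I_n := fun j i => arc B1 j i || arc B2 j i.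

Definition strongly_connected (e : rel 'I_n) : Prop :=
  forall u v : 'I_n, u != v -> connect e u v.

Definition sign_consistent B1 B2 : Prop := forall i j, 0 <= B1 i j * B2 i j.

Definition sign_inconsistent B1 B2 : Prop := ~ sign_consistent B1 B2.

Definition laplacian B : 'M[R]_n :=
  \matrix_(i, j) if i == j then \sum_(k | k != i) `|B i k| else - B i j.

End SignedDigraphs.

Section Matrices.
Variables (R : realType) (n : nat).
Implicit Types A H L : 'M[R]_n.

Definition positive_definite H : Prop :=
  H^T = H /\ forall v : 'cV[R]_n, v != 0 -> 0 < (v^T *m H *m v) 0 0.

Definition is_largest_eigenvalue A (a : R) : Prop :=
  eigenvalue A a /\ forall b, eigenvalue A b -> b <= a.

(* Only meaningful for matrices with real spectrum (here, symmetric ones);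
   the value 0 is returned when A has no real eigenvalue. *)
Definition lambda_max A : R := xget 0 [set a | is_largest_eigenvalue A a].

(* The matrix H is a definite description: 0 is returned when there is no
   positive definite solution, so any use of H as such a solution requires
   proving that one exists (and is unique). *)
Definition lyapunov_solution L : 'M[R]_n :=
  xget 0 [set H | positive_definite H /\ L^T *m H + H *m L = 1%:M].

End Matrices.

Section Systems.
Variable R : realType.

(* A solution on [0, +oo[ of dz/dt = A z, z(0) = z0; values of z at negative
   times are irrelevant, whence one-sided continuity at 0. *)
Definition is_solution (m : nat) (A : 'M[R]_m) (z0 : 'cV[R]_m)
    (z : R -> 'cV[R]_m) : Prop :=
  [/\ z 0 = z0,
      {within `[0, +oo[, continuous z} &
      forall t : R, 0 < t -> is_derive t 1 z (A *m z t)].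

Definition achieves_neutralization (n : nat) (A : 'M[R]_(n + n)) : Prop :=
  forall (x0 y0 : 'cV[R]_n) (x y : R -> 'cV[R]_n),
    is_solution A (col_mx x0 y0) (fun t => col_mx (x t) (y t)) ->
    x t @[t --> +oo] --> (0 : 'cV[R]_n) /\ y t @[t --> +oo] --> (0 : 'cV[R]_n).

End Systems.

(* Main.v *)
Require Import Defs.
From mathcomp Require Import ring lra.

(** Along the flow, u = x + y / k satisfies u' = - L x with L = L_Bc + L_Bd, so
   V = u^T H u + (delta - 1) / k^2 y^T H y has, for M = L_Bc + delta L_Bd, the
   derivative
     - |x|^2 - (2 / k) y^T H M x - (2 (delta - 1) / k) y^T H y.
   Since |M^T H y|^2 <= lambda_max(H) lambda_max(M M^T) y^T H y, this is
   negative definite as soon as k > zeta, and V decays exponentially.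

   The matrix H exists because L is weakly chained diagonally dominant: an arc
   of the union graph can only cancel in Bc + Bd at a strictly dominant row.
   The maximum principle then applies to X |-> L X + X L^T in each index of X
   separately, so this map is injective and its adjoint X |-> L^T X + X L is
   bijective. *)

(** * Bilinear forms: Cauchy-Schwarz and coercivity *)

Section BilinearForms.
Variables (R : realType) (m : nat).
Implicit Types (P A : 'M[R]_m) (u v x : 'cV[R]_m).

Definition bform P u v : R := (u^T *m P *m v) 0 0.
Definition sqnorm u : R := bform 1%:M u u.

Lemma bformE P u v : bform P u v = \sum_i \sum_j u i 0 * P i j * v j 0.
Proof.
rewrite /bform !mxE exchange_big /=; apply: eq_bigr => j _.
rewrite !mxE mulr_suml; apply: eq_bigr => i _; by rewrite mxE.
Qed.

Lemma bformDl P u v w : bform P (u + v) w = bform P u w + bform P v w.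
Proof. by rewrite /bform linearD /= !mulmxDl mxE. Qed.

Lemma bformDr P u v w : bform P w (u + v) = bform P w u + bform P w v.
Proof. by rewrite /bform mulmxDr mxE. Qed.

Lemma bformZl P a u v : bform P (a *: u) v = a * bform P u v.
Proof. by rewrite /bform linearZ /= -!scalemxAl mxE. Qed.

Lemma bformZr P a u v : bform P u (a *: v) = a * bform P u v.
Proof. by rewrite /bform -scalemxAr mxE. Qed.

Lemma bformNr P u v : bform P u (- v) = - bform P u v.
Proof. by rewrite /bform mulmxN mxE. Qed.

Lemma bformDm P Q u v : bform (P + Q) u v = bform P u v + bform Q u v.
Proof. by rewrite /bform mulmxDr mulmxDl mxE. Qed.

Lemma bformZm a P u v : bform (a *: P) u v = a * bform P u v.
Proof. by rewrite /bform -scalemxAr -scalemxAl mxE. Qed.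

Lemma bform_tr P u v : bform P^T u v = bform P v u.
Proof.
rewrite /bform -[LHS](mxE trmx_key (fun i j => (u^T *m P^T *m v) j i)).
by rewrite -/(trmx _) !trmx_mul !trmxK mulmxA.
Qed.

Lemma bform_mulr P A u v : bform P u (A *m v) = bform (P *m A) u v.
Proof. by rewrite /bform !mulmxA. Qed.

Lemma sqnormE u : sqnorm u = \sum_i u i 0 ^+ 2.
Proof.
rewrite /sqnorm /bform mulmx1 mxE; apply: eq_bigr => i _.
by rewrite mxE expr2.
Qed.

Lemma sqr_coord_le u i : u i 0 ^+ 2 <= sqnorm u.
Proof.
by rewrite sqnormE (bigD1 i)//= lerDl sumr_ge0// => j _; rewrite sqr_ge0.
Qed.

Lemma sqnorm_ge0 u : 0 <= sqnorm u.
Proof. by rewrite sqnormE sumr_ge0// => i _; rewrite sqr_ge0. Qed.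

Lemma sqnorm_gt0 u : (0 < sqnorm u) = (u != 0).
Proof.
rewrite lt_neqAle sqnorm_ge0 andbT eq_sym; congr (~~ _).
apply/eqP/eqP => [u0|->]; last first.
  by rewrite sqnormE big1// => i _; rewrite mxE expr0n.
apply/colP => i; rewrite mxE; apply/eqP; rewrite -sqrf_eq0.
by rewrite eq_le sqr_ge0 andbT -u0 sqr_coord_le.
Qed.

Lemma bform_bound P :
  exists2 C, 0 <= C & forall u, `|bform P u u| <= C * sqnorm u.
Proof.
exists (\sum_i \sum_j `|P i j|) => [|u].
  by do 2![apply: sumr_ge0 => ? _].
rewrite bformE mulr_suml; apply: le_trans (ler_norm_sum _ _ _) _.
apply: ler_sum => i _; rewrite mulr_suml.
apply: le_trans (ler_norm_sum _ _ _) _; apply: ler_sum => j _.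
rewrite mulrAC normrM mulrC; apply: ler_wpM2l => //.
have := sqr_coord_le u i; have := sqr_coord_le u j.
by rewrite ler_norml => *; apply/andP; split; nra.
Qed.

Lemma sqnorm_mul A u : sqnorm (A *m u) = bform (A^T *m A) u u.
Proof. by rewrite /sqnorm /bform trmx_mul mulmx1 !mulmxA. Qed.

Lemma sqnorm_mul_bound A :
  exists2 C, 0 < C & forall u, sqnorm (A *m u) <= C * sqnorm u.
Proof.
have [C C0 HC] := bform_bound (A^T *m A).
exists (C + 1) => [|u]; first by rewrite ltr_wpDl.
rewrite sqnorm_mul (le_trans (ler_norm _))// (le_trans (HC u))//.
by rewrite ler_wpM2r ?sqnorm_ge0// lerDl.
Qed.

Lemma exists_cV_neq0 : (0 < m)%N -> exists u : 'cV[R]_m, u != 0.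
Proof.
move=> m0; exists (const_mx 1); apply/eqP => /colP/(_ (Ordinal m0)).
by rewrite !mxE; apply/eqP/oner_neq0.
Qed.

Definition positive_semidefinite P := P^T = P /\ forall u, 0 <= bform P u u.

Lemma bform_CauchySchwarz P u v : positive_semidefinite P ->
  bform P u v ^+ 2 <= bform P u u * bform P v v.
Proof.
move=> [Psym P0]; have Q s t : 0 <= s ^+ 2 * bform P u u
    + 2 * s * t * bform P u v + t ^+ 2 * bform P v v.
  have := P0 (s *: u + t *: v).
  rewrite !(bformDl, bformDr, bformZl, bformZr) -[bform P v u]bform_tr Psym.
  by congr (0 <= _); ring.
set a := bform P u u in Q *; set c := bform P v v in Q *.
set b := bform P u v in Q *.
have a0 : 0 <= a by exact: P0.
have [c0|c0|c0] := ltgtP c 0.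
- by have := P0 v; rewrite leNgt c0.
(* The minimizing direction: there the quadratic form equals c (a c - b^2). *)
- have := Q c (- b); rewrite (_ : _ + _ = c * (a * c - b ^+ 2)); last by ring.
  by rewrite pmulr_rge0// subr_ge0.
- rewrite c0 mulr0; have [->|b0] := eqVneq b 0; first by rewrite expr0n.
  (* With c = 0 the form is affine in t, and this t gives it the value -1. *)
  have := Q 1 (- (a + 1) / (2 * b)).
  rewrite c0 (_ : _ + _ = - 1); last by field.
  by rewrite oppr_ge0 ler10.
Qed.

(** Cauchy-Schwarz at [u] and P u gives |P u|^4 <= P(u, u) P(P u, P u), and the last factor is at
    most C |P u|^2. *)
Lemma sqnorm_mul_psd P C u : positive_semidefinite P ->
    (forall x, bform P x x <= C * sqnorm x) ->
  sqnorm (P *m u) <= C * bform P u u.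
Proof.
move=> Ppsd PC; have [Psym P0] := Ppsd.
(* No sign is assumed on [C]: a negative one forces P(u, u) = 0, and then P u = 0. *)
have [C0|C0] := ltP C 0.
  have u0 : bform P u u = 0.
    apply/le_anti; rewrite P0 andbT (le_trans (PC u))//.
    by rewrite nmulr_rle0// sqnorm_ge0.
  have := bform_CauchySchwarz u (P *m u) Ppsd.
  rewrite u0 mul0r mulr0 bform_mulr -{1}Psym -sqnorm_mul => Pu.
  by have := sqnorm_ge0 (P *m u); nra.
have := bform_CauchySchwarz u (P *m u) Ppsd.
rewrite bform_mulr -{1}Psym -sqnorm_mul.
have := PC (P *m u); have := P0 u.
have := sqnorm_ge0 (P *m u).
set s := sqnorm _; set p := bform P u u; set q := bform _ _ _ => s0 p0 qs sq.
have [->|sN0] := eqVneq s 0; first by rewrite mulr_ge0.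
have {}s0 : 0 < s by rewrite lt_neqAle eq_sym sN0.
rewrite -(ler_pM2l s0) -expr2 (le_trans sq)// mulrCA mulrC mulrA.
by rewrite ler_wpM2r.
Qed.

(** Recover [u] from P u by the inverse matrix; [sqnorm_mul_psd] bounds |P u|^2 by a multiple of
    P(u, u). *)
Lemma psd_unit_coercive P : positive_semidefinite P -> P \in unitmx ->
  exists2 K, 0 < K & forall u, sqnorm u <= K * bform P u u.
Proof.
move=> Ppsd Pu; have [C C0 PC] := bform_bound P.
have [D D0 PD] := sqnorm_mul_bound (invmx P).
exists (D * (C + 1)) => [|u]; first by rewrite mulr_gt0// ltr_wpDl.
have [Psym P0] := Ppsd.
rewrite -{1}[u](mulKmx Pu) (le_trans (PD _))// -mulrA ler_wpM2l ?(ltW D0)//.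
apply: sqnorm_mul_psd => // x.
rewrite (le_trans (ler_norm _))// (le_trans (PC x))//.
by rewrite ler_wpM2r ?sqnorm_ge0// lerDl.
Qed.

End BilinearForms.

Lemma sqnorm_col_mx (R : realType) m p (x : 'cV[R]_m) (y : 'cV[R]_p) :
  sqnorm (col_mx x y) = sqnorm x + sqnorm y.
Proof.
rewrite !sqnormE big_split_ord /=.
by congr (_ + _); apply: eq_bigr => i _; rewrite ?col_mxEu ?col_mxEd.
Qed.

(** * The Rayleigh bound by the largest eigenvalue *)

Section LargestEigenvalue.
Variables (R : realType) (m : nat).
Implicit Types (A : 'M[R]_m).

(* The supremum mu of the Rayleigh quotient is an eigenvalue: otherwise mu - A
   is invertible and positive semidefinite, hence coercive, and the supremum
   could be lowered. *)
Lemma rayleigh_eigenvalue A : (0 < m)%N -> A^T = A ->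
  exists2 mu, eigenvalue A mu & forall u, bform A u u <= mu * sqnorm u.
Proof.
move=> m0 Asym; have [C C0 AC] := bform_bound A.
pose E := [set bform A u u / sqnorm u | u in [set u | u != 0]].
have ubE : ubound E C.
  move=> _ [u /= u0 <-]; rewrite ler_pdivrMr ?sqnorm_gt0//.
  exact: le_trans (ler_norm _) (AC u).
have E0 : E !=set0.
  have [u u0] := exists_cV_neq0 R m0.
  by exists (bform A u u / sqnorm u), u.
have Esup : has_sup E by split=> //; exists C.
have supE u : bform A u u <= sup E * sqnorm u.
  have [->|u0] := eqVneq u 0.
    by rewrite /sqnorm /bform !mulmx0 mxE mulr0.
  rewrite -ler_pdivrMr ?sqnorm_gt0//; apply: ub_le_sup; first by exists C.
  by exists u.
exists (sup E) => //; apply/eqP => muN.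
pose P := (sup E)%:M - A.
have bP u : bform P u u = sup E * sqnorm u - bform A u u.
  by rewrite /P -scaleN1r bformDm bformZm mulN1r -scalemx1 bformZm.
have Ppsd : positive_semidefinite P.
  split=> [|u]; first by rewrite /P linearB /= tr_scalar_mx Asym.
  by rewrite bP subr_ge0.
have Pu : P \in unitmx.
  rewrite -row_free_unit /P -opprB /row_free mxrank_opp -/(row_free _).
  by rewrite -kermx_eq0; apply/eqP.
have [K K0 PK] := psd_unit_coercive Ppsd Pu.
have : sup E <= sup E - K^-1.
  apply: ge_sup => // _ [u /= u0 <-].
  have u_gt0 : 0 < sqnorm u by rewrite sqnorm_gt0.
  rewrite ler_pdivrMr// mulrBl lerBrDl -lerBrDr -bP.
  by rewrite mulrC ler_pdivrMr// mulrC PK.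
by rewrite leNgt ltrBlDr ltrDl invr_gt0 K0.
Qed.

(** For m > 0 the Rayleigh bound is an eigenvalue dominating all others, so [lambda_max] does not
    take its default value; for m = 0 both sides vanish. *)
Lemma lambda_max_ge A u : A^T = A -> bform A u u <= lambda_max A * sqnorm u.
Proof.
move=> Asym; have [m0|] := posnP m.
  have -> : u = 0.
    apply/colP => i; exfalso.
    by have := leq_ltn_trans (leq0n i) (ltn_ord i); rewrite m0.
  by rewrite /sqnorm /bform !mulmx0 mxE mulr0.
move=> /rayleigh_eigenvalue/(_ Asym)[mu Amu muP].
have mu_max : is_largest_eigenvalue A mu.
  split=> // b /eigenvalueP[v vA v0].
  have vT0 : 0 < sqnorm v^T by rewrite sqnorm_gt0 trmx_eq0.
  have := muP v^T; rewrite {1}/bform trmxK vA -scalemxAl mxE => le_mu.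
  by rewrite -(ler_pM2r vT0) (le_trans _ le_mu)// /sqnorm /bform trmxK mulmx1.
rewrite /lambda_max; case: xgetP => [a _ [_ amax]|/(_ mu)]; last by case.
by rewrite (le_trans (muP u))// ler_wpM2r ?sqnorm_ge0// amax.
Qed.

End LargestEigenvalue.

(** * Weakly chained diagonal dominance and the maximum principle *)

Section DiagonalDominance.
Variables (R : realType) (n : nat).
Implicit Types (L H X : 'M[R]_n) (y u : 'cV[R]_n).

(** The radius of the Gershgorin disc of row [i]. *)
Definition radius L i : R := \sum_(k | k != i) `|L i k|.

Definition weakly_dominant L := forall i, radius L i <= L i i.

(** Chains run from a row to a column, against the arcs of the signed digraph. Since [connect] is
    reflexive, a strictly dominant row is chained to itself. *)
Definition chained_dominant L := weakly_dominant L /\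
  forall i, exists2 j, connect (fun i k => L i k != 0) i j & radius L j < L j j.

Lemma exists_max_coord y : y != 0 ->
  exists2 i, y i 0 != 0 & forall k, `|y k 0| <= `|y i 0|.
Proof.
move=> y0; have [i0 yi0] : exists i, y i 0 != 0.
  apply/existsP; rewrite -negb_forall; apply: contra y0 => /forallP y0.
  by apply/eqP/colP => i; rewrite mxE; apply/eqP.
have [i _ imax] := arg_maxP (fun i => `|y i 0|) (isT : xpredT i0).
exists i => [|k]; last exact: imax.
by rewrite -normr_gt0 (lt_le_trans _ (imax i0 isT))// normr_gt0.
Qed.

(** The moduli of the y_k are kept apart: the maximum principle must see that a single smaller one
    makes the estimate strict. *)
Lemma row_dominant_ge L y i : (forall k, `|y k 0| <= `|y i 0|) ->
  L i i * y i 0 ^+ 2 - \sum_(k | k != i) `|L i k| * (`|y k 0| * `|y i 0|)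
    <= (L *m y) i 0 * y i 0.
Proof.
move=> ymax; rewrite mxE [in leRHS](bigD1 i)//= mulrDl -mulrA -expr2 lerD2l.
rewrite lerNl mulr_suml -sumrN; apply: ler_sum => k _.
by rewrite -!normrM mulrA -normrN ler_norm.
Qed.

Lemma dominant_mul_ge0 L y i : weakly_dominant L ->
  (forall k, `|y k 0| <= `|y i 0|) -> 0 <= (L *m y) i 0 * y i 0.
Proof.
move=> Ldom ymax; apply: le_trans (row_dominant_ge L ymax).
rewrite subr_ge0 (@le_trans _ _ (radius L i * `|y i 0| ^+ 2))//.
  rewrite /radius mulr_suml; apply: ler_sum => k _.
  by rewrite ler_wpM2l// expr2 ler_wpM2r.
by rewrite real_normK ?num_real// ler_wpM2r ?sqr_ge0.
Qed.

(* Maximum principle: the set of indices where |y| is maximal is closed under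
   the arcs of L and contains no strictly dominant row. *)
Lemma chained_dominant_eq0 L y : chained_dominant L ->
  (forall i, (forall k, `|y k 0| <= `|y i 0|) -> (L *m y) i 0 * y i 0 <= 0) ->
  y = 0.
Proof.
move=> [Ldom Lchain] Ly; apply/eqP; rewrite -[_ == _]negbK; apply/negP => y0.
have [i yi0 imax] := exists_max_coord y0.
have M0 : 0 < `|y i 0| by rewrite normr_gt0.
have row_le j : `|y j 0| = `|y i 0| ->
    L j j * `|y i 0| <= \sum_(k | k != j) `|L j k| * `|y k 0|.
  move=> yj; have jmax k : `|y k 0| <= `|y j 0| by rewrite yj.
  have := le_trans (row_dominant_ge L jmax) (Ly _ jmax).
  rewrite subr_le0 -real_normK ?num_real// yj expr2 mulrA.
  under [in leRHS]eq_bigr do rewrite mulrA.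
  by rewrite -mulr_suml ler_pM2r.
(* A smaller |y_k| at a neighbour k would push the off-diagonal sum strictly below [radius L j]
   times the maximum, against [row_le] and weak dominance. *)
have step j k : `|y j 0| = `|y i 0| -> L j k != 0 -> `|y k 0| = `|y i 0|.
  move=> yj Ljk; have [->//|kj] := eqVneq k j.
  apply/le_anti; rewrite imax leNgt /=; apply/negP => yk.
  have := row_le _ yj; apply/negP; rewrite -ltNge.
  apply: (@lt_le_trans _ _ (radius L j * `|y i 0|)); last by rewrite ler_wpM2r.
  rewrite /radius mulr_suml (bigD1 k)//= [ltRHS](bigD1 k)//=.
  rewrite ltr_leD// ?ltr_pM2l ?normr_gt0// ler_sum// => l _.
  by rewrite ler_wpM2l.
have [j ij] := Lchain i; have yj : `|y j 0| = `|y i 0|.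
  move/connectP: ij => [p ip ->].
  suff walk q l : `|y l 0| = `|y i 0| -> path (fun i k => L i k != 0) l q ->
    `|y (last l q) 0| = `|y i 0| by exact: walk.
  elim: q l => //= k q IH l yl /andP[lk kq].
  by apply: IH => //; exact: step yl lk.
apply/negP; rewrite -leNgt -(ler_pM2r M0) (le_trans (row_le _ yj))//.
by rewrite /radius mulr_suml ler_sum// => k _; rewrite ler_wpM2l.
Qed.

(** Let q be the column of an entry of largest modulus. Wherever column q attains this modulus at
    some i, so does row i at q, and weak dominance along the row makes X L^T agree in sign with X
    there. Hence L X has the opposite sign or vanishes, and the maximum principle kills column q. *)
Lemma sylvester_inj L X : chained_dominant L ->
  L *m X + X *m L^T = 0 -> X = 0.
Proof.
move=> Lch LX; have [Ldom _] := Lch.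
apply/eqP; rewrite -[_ == _]negbK; apply/negP => X0.
have [[i0 j0] X0ij] : exists ij, X ij.1 ij.2 != 0.
  apply/existsP; rewrite -negb_forall; apply: contra X0 => /forallP X0.
  by apply/eqP/matrixP => i j; rewrite mxE; apply/eqP/(X0 (i, j)).
pose ij := [arg max_(ij > (i0, j0)) `|X ij.1 ij.2|]%O.
have ijmax k l : `|X k l| <= `|X ij.1 ij.2|.
  by rewrite /ij; case: arg_maxP => //= p _ /(_ (k, l)); apply.
have colX0 : col ij.2 X = 0.
  apply: (chained_dominant_eq0 Lch) => i imax.
  have Xi : `|X i ij.2| = `|X ij.1 ij.2|.
    by apply/le_anti; rewrite ijmax; have := imax ij.1; rewrite !mxE.
  have rmax k : `|(row i X)^T k 0| <= `|(row i X)^T ij.2 0|.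
    by rewrite !mxE Xi.
  have := dominant_mul_ge0 Ldom rmax.
  have -> : (L *m (row i X)^T) ij.2 0 = (X *m L^T) i ij.2.
    by rewrite !mxE; apply: eq_bigr => k _; rewrite !mxE mulrC.
  move/matrixP/(_ i ij.2): LX; rewrite mxE [RHS]mxE => /eqP.
  rewrite addr_eq0 => /eqP LXi.
  have -> : (L *m col ij.2 X) i 0 = (L *m X) i ij.2.
    by rewrite !mxE; apply: eq_bigr => k _; rewrite mxE.
  by rewrite LXi !mxE mulNr oppr_le0.
have := ijmax i0 j0; move/colP/(_ ij.1): colX0; rewrite !mxE => ->.
by rewrite normr0 normr_le0 (negPf X0ij).
Qed.

End DiagonalDominance.

(** * The Lyapunov equation: solvability and positive definiteness *)

Section LyapunovEquation.
Variables (R : realType) (n : nat).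
Implicit Types (L H X Y : 'M[R]_n) (x y u : 'cV[R]_n).

Lemma linear_inj_surj (f : {linear 'M[R]_n -> 'M[R]_n}) :
  (forall X, f X = 0 -> X = 0) -> forall Y, exists X, f X = Y.
Proof.
move=> finj Y; have Ff : lin_mx f \in unitmx.
  rewrite -row_free_unit -kermx_eq0; apply/rowV0P => v /sub_kermxP vf0.
  rewrite -[v]vec_mxK (finj (vec_mx v)) ?linear0//.
  by rewrite -[f _]mxvecK -mul_rV_lin vf0 linear0.
exists (vec_mx (mxvec Y *m invmx (lin_mx f))).
by rewrite -[f _]mxvecK -mul_rV_lin mulmxKV// mxvecK.
Qed.

Lemma trace_gram_eq0 X : \tr (X^T *m X) = 0 -> X = 0.
Proof.
move=> tr0; apply/matrixP => i j; rewrite mxE; apply/eqP; rewrite -sqrf_eq0.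
have G0 k : 0 <= (X^T *m X) k k.
  by rewrite mxE sumr_ge0// => l _; rewrite mxE -expr2 sqr_ge0.
rewrite eq_le sqr_ge0 andbT -tr0 /mxtrace (bigD1 j)//=.
rewrite (@le_trans _ _ ((X^T *m X) j j))//; last by rewrite lerDl sumr_ge0.
rewrite mxE (bigD1 i)//= mxE expr2 lerDl sumr_ge0// => l _.
by rewrite mxE -expr2 sqr_ge0.
Qed.

(* The map is adjoint, for the trace pairing, to the map of sylvester_inj. *)
Lemma lyapunov_inj L X : chained_dominant L ->
  L^T *m X + X *m L = 0 -> X = 0.
Proof.
move=> Lch LX; pose f := (mulmx L \+ mulmxr L^T : 'M[R]_n -> 'M[R]_n).
have [|Y fY] := @linear_inj_surj (f : {linear 'M[R]_n -> 'M[R]_n}) _ X.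
  by move=> Z; exact: sylvester_inj.
(* With X = L Y + Y L^T, tr(X^T X) = tr((L^T X + X L)^T Y) = 0. *)
apply: trace_gram_eq0; rewrite -{2}fY /= mulmxDr raddfD /= mulmxA.
rewrite mulmxA [X in _ + X]mxtrace_mulC mulmxA -raddfD /= -mulmxDl.
have := congr1 trmx LX; rewrite linearD /= !trmx_mul trmxK linear0 => ->.
by rewrite mul0mx mxtrace0.
Qed.

Lemma lyapunov_exists L : chained_dominant L ->
  exists2 H, H^T = H & L^T *m H + H *m L = 1%:M.
Proof.
move=> Lch; pose g := (mulmx L^T \+ mulmxr L : 'M[R]_n -> 'M[R]_n).
have [|H gH] := @linear_inj_surj (g : {linear 'M[R]_n -> 'M[R]_n}) _ 1%:M.
  by move=> Z; exact: lyapunov_inj.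
(* H^T solves the same equation, so H^T - H lies in a trivial kernel. *)
exists H => //; apply/eqP; rewrite -subr_eq0; apply/eqP.
apply: (lyapunov_inj Lch); rewrite mulmxBr mulmxBl addrACA -opprD.
move: gH => /= gH; rewrite gH -[X in _ - X]trmx1 -gH.
by rewrite linearD /= !trmx_mul trmxK addrC subrr.
Qed.

(** At a maximal coordinate L y never opposes y in sign, so adding h L y cannot shrink it: the
    inverse of 1 + h L is nonexpansive in the sup norm. *)
Lemma euler_contraction L h y i : weakly_dominant L -> 0 < h ->
    (forall k, `|y k 0| <= `|y i 0|) ->
  `|y i 0| <= `|((1%:M + h *: L) *m y) i 0|.
Proof.
move=> Ldom h0 ymax; have [->|yi0] := eqVneq (y i 0) 0; first by rewrite normr0.
have Ly := dominant_mul_ge0 Ldom ymax.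
have y_gt0 : 0 < `|y i 0| by rewrite normr_gt0.
rewrite -(ler_pM2r y_gt0) -[leRHS]normrM.
rewrite -expr2 real_normK ?num_real// ger0_norm mulmxDl mul1mx -scalemxAl mxE.
  by rewrite [in leRHS]mxE mulrDl -expr2 lerDl -mulrA mulr_ge0// ltW.
by rewrite mulrDl -expr2 addr_ge0 ?sqr_ge0// mxE -mulrA mulr_ge0// ltW.
Qed.

Lemma euler_unit L h : weakly_dominant L -> 0 < h ->
  1%:M + h *: L \in unitmx.
Proof.
move=> Ldom h0; rewrite -unitmx_tr -row_free_unit -kermx_eq0.
apply/rowV0P => v /sub_kermxP vL; apply/eqP; rewrite -trmx_eq0 -[_ == _]negbK.
apply/negP => /exists_max_coord[i vi0 imax].
have := euler_contraction Ldom h0 imax.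
have -> : (1%:M + h *: L) *m v^T = 0.
  by have := congr1 trmx vL; rewrite trmx_mul trmxK linear0.
by rewrite [in leRHS]mxE normr0 normr_le0 (negPf vi0).
Qed.

(* An implicit Euler step of x' = - L x does not increase the sup norm of x and
   decreases H(x, x) by a fixed multiple of |x|^2, so a lower bound - K |x|^2
   of the form can be improved until K is negative. *)
Lemma lyapunov_posdef L H : weakly_dominant L -> H^T = H ->
  L^T *m H + H *m L = 1%:M -> positive_definite H.
Proof.
move=> Ldom Hsym HL; have [C C0 HC] := bform_bound (L^T *m H *m L).
(* So small that the second-order term h^2 H(L y, L y) costs at most half of the gain h |y|^2. *)
pose h := (2 * (C + 1))^-1.
have h0 : 0 < h by rewrite invr_gt0 mulr_gt0// ltr_wpDl.
have hC : h * C <= 2^-1.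
  rewrite /h invfM -mulrA ler_piMr ?invr_ge0// mulrC.
  by rewrite ler_pdivrMr ?ltr_wpDl// mul1r lerDl.
pose E := 1%:M + h *: L; have Eu : E \in unitmx by exact: euler_unit.
have [D D0 ED] := sqnorm_mul_bound E.
(* The remaining gain h / 2 |y|^2, expressed through |E y|^2 <= D |y|^2. *)
pose c := h / (2 * D); have c0 : 0 < c by rewrite divr_gt0// mulr_gt0.
have descent y : bform H y y + c * sqnorm (E *m y) <= bform H (E *m y) (E *m y).
  have HLy : bform H y (L *m y) *+ 2 = sqnorm y.
    rewrite mulr2n bform_mulr -{1}bform_tr trmx_mul Hsym -bformDm.
    by rewrite HL.
  have HLL : bform H (L *m y) (L *m y) = bform (L^T *m H *m L) y y.
    by rewrite /bform trmx_mul !mulmxA.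
  have EyE : bform H (E *m y) (E *m y) =
      bform H y y + h * (bform H y (L *m y) *+ 2)
      + h ^+ 2 * bform (L^T *m H *m L) y y.
    rewrite /E mulmxDl mul1mx -scalemxAl !(bformDl, bformDr, bformZl, bformZr).
    by rewrite HLL -[bform H (L *m y) y]bform_tr Hsym; ring.
  rewrite EyE HLy -addrA lerD2l.
  have hh : - (h / 2) * sqnorm y <= h ^+ 2 * bform (L^T *m H *m L) y y.
    rewrite mulNr lerNl -mulrN expr2 -!mulrA (ler_wpM2l (ltW h0))//.
    rewrite (@le_trans _ _ (h * (C * sqnorm y)))//.
      by rewrite (ler_wpM2l (ltW h0))// (le_trans _ (HC y))// -normrN ler_norm.
    by rewrite mulrA ler_wpM2r ?sqnorm_ge0.
  have cE : c * sqnorm (E *m y) <= h / 2 * sqnorm y.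
    rewrite (le_trans (ler_wpM2l (ltW c0) (ED y)))//.
    rewrite mulrA ler_wpM2r ?sqnorm_ge0//.
    by rewrite /c invfM !mulrA mulfVK// gt_eqF.
  by move: hh cE; lra.
(* The bound is measured in the sup norm, for which the Euler step is nonexpansive. *)
pose S K := forall x i, (forall k, `|x k 0| <= `|x i 0|) ->
  - K * x i 0 ^+ 2 <= bform H x x.
have improve K : 0 <= K -> S K -> S (K - c).
  move=> K0 SK x i xmax; have xE : E *m (invmx E *m x) = x by rewrite mulKVmx.
  have := descent (invmx E *m x); rewrite xE; set y := invmx E *m x => le_Hx.
  suff HK : - K * x i 0 ^+ 2 <= bform H y y.
    have := ler_wpM2l (ltW c0) (sqr_coord_le x i).
    by move: le_Hx HK; lra.
  have [y0|/exists_max_coord[j _ ymax]] := eqVneq y 0.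
    by rewrite y0 /bform !mulmx0 mxE mulNr oppr_le0 mulr_ge0 ?sqr_ge0.
  apply: le_trans (SK _ _ ymax); rewrite !mulNr lerN2 ler_wpM2l//.
  rewrite -[leLHS]real_normK ?num_real// -[leRHS]real_normK ?num_real//.
  rewrite ler_pXn2r ?nnegrE// (le_trans _ (xmax j))// -xE.
  exact: euler_contraction.
have [K1 K10 HK1] := bform_bound H.
(* Starting value: |x|^2 is at most n times the largest squared coordinate. *)
have SK1 : S (K1 * n%:R).
  move=> x i xmax; rewrite mulNr lerNl -mulrA.
  rewrite (@le_trans _ _ (K1 * sqnorm x))//.
    by rewrite (le_trans _ (HK1 x))// -normrN ler_norm.
  rewrite ler_wpM2l// sqnormE -[X in X%:R]card_ord mulr_natl -sumr_const.
  apply: ler_sum => k _.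
  rewrite -[leLHS]real_normK ?num_real// -[leRHS]real_normK ?num_real//.
  by rewrite ler_pXn2r ?nnegrE.
(* Each improvement subtracts the same [c], so finitely many suffice. *)
have [K Kneg SK] : exists2 K, K < 0 & S K.
  have [N] : exists N : nat, K1 * n%:R < N%:R * c.
    exists (Num.bound (K1 * n%:R / c)); rewrite -ltr_pdivrMr//.
    by apply: archi_boundP; rewrite divr_ge0 ?(ltW c0)// mulr_ge0.
  elim: N (K1 * n%:R) SK1 => [|N IH] K SK; first by rewrite mul0r; exists K.
  move=> ltK; have [|K0] := ltP K 0; first by exists K.
  apply: (IH (K - c)); first exact: improve.
  by move: ltK; rewrite -natr1 mulrDl mul1r ltrBlDr.
split=> // v /exists_max_coord[i vi0 vmax]; apply: lt_le_trans (SK _ _ vmax).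
by rewrite pmulr_rgt0 ?oppr_gt0// lt_neqAle eq_sym sqrf_eq0 vi0 sqr_ge0.
Qed.

(** Existence of a solution rules out the default value of [xget]. *)
Lemma lyapunov_solutionP L : chained_dominant L ->
  let H := lyapunov_solution L in
  positive_definite H /\ L^T *m H + H *m L = 1%:M.
Proof.
move=> Lch /=; have [H Hsym HL] := lyapunov_exists Lch.
rewrite /lyapunov_solution; case: xgetP => [H' _ //|/(_ H)].
by case; split=> //; case: Lch => Ldom _; exact: lyapunov_posdef HL.
Qed.

End LyapunovEquation.

(** * Dominance of the sum of two Laplacians *)

Section LaplacianSum.
Variables (R : realType) (n : nat) (Bc Bd : 'M[R]_n).
Hypothesis adj_Bc : adjacency_matrix Bc.
Let L := laplacian Bc + laplacian Bd.

Lemma laplacian_sum_diag i :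
  L i i = \sum_(k | k != i) (`|Bc i k| + `|Bd i k|).
Proof. by rewrite !mxE eqxx big_split. Qed.

Lemma laplacian_sum_radius i :
  radius L i = \sum_(k | k != i) `|Bc i k + Bd i k|.
Proof.
apply: eq_bigr => k ki; rewrite !mxE eq_sym (negPf ki).
by rewrite -opprD normrN.
Qed.

(** Opposite signs make the triangle inequality strict in the k-th term; the zero diagonal ensures
    that this term is off the diagonal. *)
Lemma laplacian_sum_strict i k : Bc i k * Bd i k < 0 -> radius L i < L i i.
Proof.
move=> B0; have ki : k != i.
  by apply: contraTneq B0 => ->; rewrite adj_Bc mul0r ltxx.
rewrite laplacian_sum_radius laplacian_sum_diag.
rewrite (bigD1 k)//= [ltRHS](bigD1 k)//=.
apply: ltr_leD; last by apply: ler_sum => l _; exact: ler_normD.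
have [c0|c0|c0] := ltgtP (Bc i k) 0; last by move: B0; rewrite c0 mul0r ltxx.
- have d0 : 0 < Bd i k by rewrite -(nmulr_rlt0 _ c0).
  rewrite (ltr0_norm c0) (gtr0_norm d0) ltr_norml; apply/andP; split; lra.
- have d0 : Bd i k < 0 by rewrite -(pmulr_rlt0 _ c0).
  rewrite (gtr0_norm c0) (ltr0_norm d0) ltr_norml; apply/andP; split; lra.
Qed.

(* An arc of the union graph may cancel in Bc + Bd, but then its head is a
   strictly dominant row. *)
Lemma laplacian_sum_chained : sign_inconsistent Bc Bd ->
  strongly_connected (union_arc Bc Bd) -> chained_dominant L.
Proof.
move=> inc conn; split=> [i|i].
  rewrite laplacian_sum_radius laplacian_sum_diag.
  by apply: ler_sum => k _; exact: ler_normD.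
have [j [k jk]] : exists j k, Bc j k * Bd j k < 0.
  apply: contrapT => no; apply: inc => j k; rewrite leNgt; apply/negP => jk.
  by apply: no; exists j, k.
have sj := laplacian_sum_strict jk.
pose Q i := exists2 l, connect (fun i k => L i k != 0) i l & radius L l < L l l.
(* Chains of [L] run against the arcs, so [Q] passes from the tail of an arc to its head, starting
   at the strict row [j]. *)
suff walk q l : Q l -> path (union_arc Bc Bd) l q -> Q (last l q).
  have Qj : Q j by exists j; rewrite ?connect0.
  have [<-//|ji] := eqVneq j i.
  by have /connectP[q jq ->] := conn _ _ ji; exact: walk.
elim: q l => //= u q IH l Ql /andP[lu uq]; apply: IH => //.
have [ul|ul] := eqVneq u l; first by rewrite ul.
have Lul : L u l = - (Bc u l + Bd u l) by rewrite !mxE (negPf ul) opprD.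
have [Lul0|Lul0] := eqVneq (L u l) 0; last first.
  by have [m lm sm] := Ql; exists m => //; exact: connect_trans (connect1 _) lm.
exists u; rewrite ?connect0//; apply: (@laplacian_sum_strict _ l).
move: Lul lu; rewrite Lul0 => /esym/eqP; rewrite oppr_eq0 addr_eq0 => /eqP cd.
rewrite /union_arc /arc cd oppr_eq0 orbb => d0.
by rewrite mulNr oppr_lt0 -expr2 lt_neqAle eq_sym sqrf_eq0 d0 sqr_ge0.
Qed.

End LaplacianSum.

(** * Exponential decay of quadratic forms along linear flows *)

Section LinearFlow.
Variables (R : realType).

Lemma is_derive_bform m (P : 'M[R]_m) (z : R -> 'cV[R]_m) (t : R) dz :
  is_derive t 1 z dz ->
  is_derive t 1 (fun s => bform P (z s) (z s))
    (bform P dz (z t) + bform P (z t) dz).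
Proof.
move=> dzt; have zt := @ex_derive _ _ _ _ _ _ _ dzt.
have coord i : is_derive t 1 (fun s => z s i 0) (dz i 0).
  split; first by move/derivable_mxP : zt; apply.
  have := @derive_val _ _ _ _ _ _ _ dzt; rewrite derive_mx// => <-.
  by rewrite mxE.
have -> : (fun s => bform P (z s) (z s)) =
    \sum_i \sum_j (P i j \*: ((fun s => z s i 0) * (fun s => z s j 0))).
  apply/funext => s; rewrite bformE fct_sumE; apply: eq_bigr => i _.
  rewrite fct_sumE; apply: eq_bigr => j _.
  by rewrite /= [RHS]mulrCA mulrA.
apply: is_derive_eq.
rewrite !bformE -big_split; apply: eq_bigr => i _.
rewrite -big_split; apply: eq_bigr => j _ /=.
by rewrite /GRing.scale /=; ring.
Qed.

Lemma continuous_bform m (P : 'M[R]_m) : continuous (fun v => bform P v v).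
Proof.
have -> : (fun v => bform P v v) =
    (fun v : 'cV[R]_m => \sum_i \sum_j v i 0 * P i j * v j 0).
  by apply/funext => v; rewrite bformE.
apply: (@continuous_big _ _ +%R) => [|i _]; first exact: add_continuous.
apply: (@continuous_big _ _ +%R) => [|j _]; first exact: add_continuous.
move=> v; have ci := @coord_continuous R m 1 i 0 v.
exact: cvgM (cvgM ci (cvg_cst _)) (@coord_continuous R m 1 j 0 v).
Qed.

(** A Gronwall argument: [W] is continuous on [0, +oo[ with nonpositive derivative in the interior,
    hence never exceeds its initial value. *)
Lemma lyapunov_decay m (A P : 'M[R]_m) c z0 z : P^T = P ->
    (forall v, 2 * bform P v (A *m v) <= - c * bform P v v) ->
    is_solution A z0 z ->
  forall t : R, 0 <= t ->
    bform P (z t) (z t) <= bform P z0 z0 * expR (- (c * t)).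
Proof.
move=> Psym dec [<- cz dz] t t0.
pose V (s : R) := bform P (z s) (z s); pose W (s : R) : R := expR (c * s) * V s.
have dW (s : R) : 0 < s ->
    is_derive s 1 W (expR (c * s) * (c * V s + 2 * bform P (z s) (A *m z s))).
  move=> s0; have := is_derive_bform P (dz s s0) => dV.
  have -> : W = (expR \o ( *%R c)) * V by [].
  have dE : is_derive s 1 (expR \o ( *%R c)) (expR (c * s) * c).
    apply: is_derive1_comp; have -> : *%R c = c \*: (id : R -> R) by [].
    by apply: is_derive_eq; rewrite /GRing.scale /= mulr1.
  apply: is_derive_eq.
  rewrite -[bform P (A *m z s) (z s)]bform_tr Psym /GRing.scale /= -/(V s).
  by ring.
have le_W : W t <= W 0.
  apply: (@ler0_derive1_nincry _ W 0) => //.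
  - by move=> x; rewrite in_itv/= andbT => /dW[].
  - move=> x; rewrite in_itv/= andbT => x0; have := dW _ x0 => dWx.
    rewrite derive1E derive_val pmulr_rle0 ?expR_gt0//.
    by have := dec (z x); rewrite mulNr -/(V x); lra.
  - have cV : {within `[0, +oo[, continuous V}.
      apply: (@within_continuous_comp _ _ _ _ z (fun v => bform P v v)) => //.
      move=> v _.
      exact: continuous_bform.
    have cE : {within `[0, +oo[, continuous (fun s => expR (c * s))}.
      apply: continuous_subspaceT => s; apply: continuous_comp.
        exact: mulrl_continuous.
      exact: continuous_expR.
    by move=> s; exact: cvgM (cE s) (cV s).
move: le_W; rewrite /W mulr0 expR0 mul1r -(ler_pM2l (expR_gt0 (- (c * t)))).
by rewrite mulrA -expRD addNr expR0 mul1r mulrC.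
Qed.

Lemma cvg_sqnorm0 m (z : R -> 'cV[R]_m) K c : 0 < c ->
    (forall t : R, 0 <= t -> sqnorm (z t) <= K * expR (- (c * t))) ->
  z t @[t --> +oo] --> (0 : 'cV[R]_m).
Proof.
move=> c0 zK; apply: norm_cvg0.
have cvgE : K * expR (- (c * t)) @[t --> +oo] --> (0 : R).
  rewrite -[X in _ --> X](mulr0 K); apply: cvgMl_tmp.
  apply: (@cvg_comp _ _ _ (fun t => c * t) (fun t => expR (- t))).
    by apply: gt0_cvgMry => //; exact: cvg_id.
  exact: cvgr_expR.
apply/cvgrPdist_lt => e e0; rewrite /=.
move/cvgrPdist_lt : cvgE => /(_ (e ^+ 2)); rewrite exprn_gt0// => /(_ isT) cvgE.
near=> t; rewrite sub0r normrN normr_id.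
have t0 : 0 <= t by near: t; apply: nbhs_pinfty_ge; rewrite num_real.
(* Convergence is in the max norm, which, unless zero, is attained at a coordinate. *)
have [z0|/mx_norm_neq0[[i j] /= zE]] := eqVneq (mx_norm (z t)) 0.
  by rewrite [`|_|]z0.
rewrite [`|_|]zE -(ltr_pXn2r (_ : 0 < 2)%N) ?nnegrE// ?(ltW e0)//.
rewrite real_normK ?num_real//.
rewrite ord1 (le_lt_trans (sqr_coord_le _ _))// (le_lt_trans (zK t t0))//.
rewrite (le_lt_trans (ler_norm _))// -normrN -sub0r.
by near: t.
Unshelve. all: by end_near.
Qed.

End LinearFlow.

(** * Inequalities for positive definite forms *)

Section PositiveDefinite.
Variables (R : realType) (m : nat).
Implicit Types (H : 'M[R]_m).

Lemma posdef_psd H : positive_definite H -> positive_semidefinite H.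
Proof.
move=> [Hsym Hpos]; split=> // u; have [->|/Hpos/ltW//] := eqVneq u 0.
by rewrite /bform mulmx0 mxE.
Qed.

Lemma posdef_unit H : positive_definite H -> H \in unitmx.
Proof.
move=> [Hsym Hpos]; rewrite -row_free_unit -kermx_eq0.
apply/rowV0P => v /sub_kermxP vH; apply/eqP; rewrite -trmx_eq0 -[_ == _]negbK.
by apply/negP => /Hpos; rewrite trmxK vH mul0mx mxE ltxx.
Qed.

Lemma posdef_lambda_max_gt0 H :
  (0 < m)%N -> positive_definite H -> 0 < lambda_max H.
Proof.
move=> m0 [Hsym Hpos]; have [u u0] := exists_cV_neq0 R m0.
have := lt_le_trans (Hpos u u0) (lambda_max_ge u Hsym).
by rewrite pmulr_lgt0// sqnorm_gt0.
Qed.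

Lemma gram_lambda_max_ge0 (M : 'M[R]_m) :
  (0 < m)%N -> 0 <= lambda_max (M *m M^T).
Proof.
move=> m0; have [u u0] := exists_cV_neq0 R m0.
have sym : (M *m M^T)^T = M *m M^T by rewrite trmx_mul trmxK.
have := lambda_max_ge u sym; rewrite -{1}[M]trmxK -sqnorm_mul.
move=> /(le_trans (sqnorm_ge0 _)).
by rewrite pmulr_lge0// sqnorm_gt0.
Qed.

(** The parallelogram identity without its nonnegative term H(u - v, u - v). *)
Lemma bform_parallelogram H u v : positive_semidefinite H ->
  bform H (u + v) (u + v) <= 2 * bform H u u + 2 * bform H v v.
Proof.
move=> [Hsym H0]; have := H0 (u - v).
rewrite !(bformDl, bformDr, bformNr) -[- v]scaleN1r !bformZl.
by rewrite -[bform H v u]bform_tr Hsym; lra.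
Qed.

(** Young's inequality: expand |u + s v|^2 >= 0 and divide by [s]. *)
Lemma sqnorm_AMGM (s : R) (u v : 'cV[R]_m) : 0 < s ->
  - (s * sqnorm v + sqnorm u / s) <= 2 * bform 1%:M u v.
Proof.
move=> s0; have := sqnorm_ge0 (u + s *: v).
rewrite /sqnorm !(bformDl, bformDr, bformZl, bformZr).
rewrite -[bform _ v u]bform_tr trmx1 -(pmulr_rge0 _ (_ : 0 < s^-1)) ?invr_gt0//.
set a := bform _ u u; set b := bform _ u v; set d := bform _ v v.
have -> : s^-1 * (a + s * b + (s * b + s * (s * d))) = a / s + 2 * b + s * d.
  by field; rewrite gt_eqF.
by move: (a / s) (s * d) => p q; lra.
Qed.

End PositiveDefinite.

(** * The Lyapunov function of the coupled system *)

Section Neutralization.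
Variables (R : realType) (n : nat) (Lc Ld H : 'M[R]_n) (delta k : R).
Let L := Lc + Ld.
Let M := Lc + delta *: Ld.
Let A := block_mx (- Lc) 1%:M (- (k *: Ld)) (- k%:M).
Let zeta := lambda_max H * lambda_max (M *m M^T) / (2 * (delta - 1)).

(* V(x, y) = H(x + y / k, x + y / k) + a H(y, y); along the flow x + y / k has
   derivative - L x, and a is chosen so that the cross terms in y and x combine
   into H(y, M x). *)
Let U : 'M[R]_(n, n + n) := row_mx 1%:M k^-1%:M.
Let Y : 'M[R]_(n, n + n) := row_mx 0 1%:M.
Let a := (delta - 1) / k ^+ 2.
Let P := U^T *m H *m U + a *: (Y^T *m H *m Y).

Hypotheses (Hpos : positive_definite H) (HL : L^T *m H + H *m L = 1%:M).
Hypotheses (n_gt0 : (0 < n)%N) (delta_gt1 : 1 < delta) (zeta_lt : zeta < k).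

Let U_col (x y : 'cV[R]_n) : U *m col_mx x y = x + k^-1 *: y.
Proof. by rewrite mul_row_col mul1mx mul_scalar_mx. Qed.

Let Y_col (x y : 'cV[R]_n) : Y *m col_mx x y = y.
Proof. by rewrite mul_row_col mul0mx mul1mx add0r. Qed.

Let bformP x y v : bform P (col_mx x y) v =
  bform H (x + k^-1 *: y) (U *m v) + a * bform H y (Y *m v).
Proof.
transitivity (bform H (U *m col_mx x y) (U *m v)
  + a * bform H (Y *m col_mx x y) (Y *m v)); last by rewrite U_col Y_col.
by rewrite /P bformDm bformZm /bform !trmx_mul !mulmxA.
Qed.

Let zeta_ge0 : 0 <= zeta.
Proof.
apply: divr_ge0.
  apply: mulr_ge0; last exact: gram_lambda_max_ge0.
  exact: ltW (posdef_lambda_max_gt0 n_gt0 Hpos).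
by apply: mulr_ge0 => //; rewrite subr_ge0; exact: ltW.
Qed.

Let k_gt0 : 0 < k. Proof. exact: le_lt_trans zeta_lt. Qed.

Let a_gt0 : 0 < a.
Proof. by rewrite divr_gt0 ?exprn_gt0// subr_gt0. Qed.

Let V x y : R := bform P (col_mx x y) (col_mx x y).

Let VE x y : V x y =
  bform H (x + k^-1 *: y) (x + k^-1 *: y) + a * bform H y y.
Proof. by rewrite /V bformP U_col Y_col. Qed.

Lemma neutralization_derivative x y :
  2 * bform P (col_mx x y) (A *m col_mx x y) =
  - sqnorm x - 2 / k * bform H y (M *m x) - 2 * (delta - 1) / k * bform H y y.
Proof.
have kN0 : k != 0 by rewrite gt_eqF.
have [Hsym _] := Hpos.
have HLx : 2 * bform H x (L *m x) = sqnorm x.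
  by rewrite mulr_natl mulr2n bform_mulr -{1}bform_tr trmx_mul Hsym -bformDm HL.
have YA : Y *m (A *m col_mx x y) = - (k *: (Ld *m x + y)).
  rewrite mul_block_col mul_row_col mul0mx mul1mx add0r.
  by rewrite !mulNmx mul_scalar_mx -scalemxAl scalerDr opprD.
have UA : U *m (A *m col_mx x y) = - (L *m x).
  rewrite mul_block_col mul_row_col !mul1mx mul_scalar_mx !mulNmx mul_scalar_mx.
  rewrite -scalemxAl -opprD -scalerDr scalerN scalerA mulVf// scale1r opprD.
  by rewrite addrACA subrr addr0 -opprD -mulmxDl.
rewrite bformP YA UA !(bformNr, bformZr) bformDr bformDl bformZl.
(* The [L] part is the cross term from x + y / k, the [Ld] part the one from the weight [a]. *)
have -> : M *m x = L *m x + (delta - 1) *: (Ld *m x).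
  rewrite scalemxAl -mulmxDl /M /L scalerBl scale1r.
  by rewrite -addrA [Ld + _]addrC subrK.
rewrite bformDr bformZr -HLx /a.
by field.
Qed.

Lemma neutralization_coercive : exists2 K, 0 < K &
  forall v, sqnorm v <= K * bform P v v.
Proof.
have Hpsd := posdef_psd Hpos.
have [K K0 HK] := psd_unit_coercive Hpsd (posdef_unit Hpos).
(* Writing x = (x + y / k) - y / k gives H(x, x) + H(y, y) <= 2 H(x + y / k, x + y / k) + (2 / k^2 +
   1) H(y, y). *)
exists (K * (2 + (2 / k ^+ 2 + 1) / a)) => [|v].
  by rewrite mulr_gt0// addr_gt0// divr_gt0// addr_gt0// divr_gt0 ?exprn_gt0.
rewrite -[v]vsubmxK; set x := usubmx v; set y := dsubmx v.
rewrite sqnorm_col_mx -/(V x y) VE -mulrA.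
rewrite (le_trans (lerD (HK x) (HK y)))// -mulrDr ler_wpM2l//; first exact: ltW.
have := bform_parallelogram (x + k^-1 *: y) (- k^-1 *: y) Hpsd.
rewrite {1 2}scaleNr addrK bformZl bformZr.
have [_ /(_ y)] := Hpsd; have [_ /(_ (x + k^-1 *: y))] := Hpsd.
set p := bform H y y; set w := bform H (_ + _) _.
set q := bform H x x => w0 p0 qw.
have k2_gt0 : 0 < 2 / k ^+ 2 by rewrite divr_gt0 ?exprn_gt0.
have {}qw : q <= 2 * w + 2 / k ^+ 2 * p.
  rewrite (_ : 2 / k ^+ 2 * p = 2 * (- k^-1 * (- k^-1 * p)))//.
  by field; rewrite gt_eqF.
move: (2 / k ^+ 2) k2_gt0 => b b0 in qw *.
have -> : (2 + (b + 1) / a) * (w + a * p) =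
    2 * w + (b + 1) * p + (2 * (a * p) + (b + 1) / a * w).
  by field; rewrite gt_eqF.
have le_qp : q + p <= 2 * w + (b + 1) * p.
  by rewrite [(b + 1) * p]mulrDl mul1r addrA lerD2r.
rewrite (le_trans le_qp)// lerDl addr_ge0//.
  by rewrite mulr_ge0// mulr_ge0// ltW.
by rewrite mulr_ge0// divr_ge0 ?(ltW a_gt0)// addr_ge0// ltW.
Qed.

(** The cross term pairs x with w = M^T H y, where |w|^2 <= lambda_max(H) lambda_max(M M^T) H(y, y);
    Young's inequality splits it between |x|^2 and H(y, y). *)
Lemma neutralization_decay : exists2 c, 0 < c &
  forall v, 2 * bform P v (A *m v) <= - c * bform P v v.
Proof.
have Hpsd := posdef_psd Hpos; have [Hsym H_ge0] := Hpsd.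
have lH_gt0 := posdef_lambda_max_gt0 n_gt0 Hpos.
have lM_ge0 := gram_lambda_max_ge0 M n_gt0.
set lH := lambda_max H in lH_gt0; set lM := lambda_max _ in lM_ge0.
have d_gt0 : 0 < 2 * (delta - 1) by rewrite mulr_gt0// subr_gt0.
(* The Young weight lies strictly between: s < k makes [c1] positive, s > zeta makes [c2]
   positive. *)
pose s := (zeta + k) / 2.
have zeta_s : zeta < s by exact: (midf_lt zeta_lt).1.
have s_k : s < k by exact: (midf_lt zeta_lt).2.
have s_gt0 : 0 < s by exact: le_lt_trans zeta_s.
pose c1 := 1 - s / k.
have c1_gt0 : 0 < c1 by rewrite subr_gt0 ltr_pdivrMr// mul1r.
pose c2 := (2 * (delta - 1) - lH * lM / s) / k.
have c2_gt0 : 0 < c2.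
  by rewrite divr_gt0// subr_gt0 ltr_pdivrMr// [ltRHS]mulrC -ltr_pdivrMr.
pose b := 2 / k ^+ 2 + a.
have b_gt0 : 0 < b by rewrite addr_gt0// divr_gt0// exprn_gt0.
(* Since V <= 2 H(x, x) + b H(y, y) and H(x, x) <= lH |x|^2, this rate gives c V <= c1 |x|^2 + c2
   H(y, y). *)
pose c := Num.min (c1 / (2 * lH)) (c2 / b).
have c_gt0 : 0 < c.
  rewrite lt_min; apply/andP; split; apply: divr_gt0 => //.
  exact: mulr_gt0.
exists c => // v; rewrite -[v]vsubmxK; move: (usubmx v) (dsubmx v) => x y {v}.
rewrite neutralization_derivative -/(V x y) VE.
have le_q : bform H x x <= lH * sqnorm x by exact: lambda_max_ge.
have Hxx := H_ge0 x; have Hyy := H_ge0 y.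
have le_w : sqnorm (M^T *m (H *m y)) <= lH * lM * bform H y y.
  rewrite sqnorm_mul trmxK (le_trans (lambda_max_ge _ _))//.
    by rewrite trmx_mul trmxK.
  rewrite -/lM [lH * lM]mulrC -mulrA ler_wpM2l//.
  by apply: sqnorm_mul_psd => // u; exact: lambda_max_ge.
have HMx : bform H y (M *m x) = bform 1%:M (M^T *m (H *m y)) x.
  by rewrite /bform !trmx_mul trmxK Hsym mulmx1 !mulmxA.
have := sqnorm_AMGM (M^T *m (H *m y)) x s_gt0.
have := bform_parallelogram x (k^-1 *: y) Hpsd.
rewrite HMx !(bformZl, bformZr).
move: (bform 1%:M _ _) (bform H (_ + _) _) => wx V1.
move: (sqnorm (_ *m _)) le_w => w le_w.
move: (bform H x x) (bform H y y) (sqnorm x) Hxx Hyy le_q le_w.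
move=> q p N q0 p0 le_q le_w.
have -> : 2 * (k^-1 * (k^-1 * p)) = 2 / k ^+ 2 * p by field; rewrite gt_eqF.
move=> le_V1 le_wx.
have step1 : - N - 2 / k * wx - 2 * (delta - 1) / k * p <= - (c1 * N + c2 * p).
  have le_wsk : k^-1 * - (2 * wx) <= k^-1 * (s * N + lH * lM / s * p).
    rewrite ler_pM2l ?invr_gt0// lerNl (le_trans _ le_wx)// lerN2 lerD2l.
    by rewrite mulrAC ler_pM2r ?invr_gt0.
  have -> : - N - 2 / k * wx - 2 * (delta - 1) / k * p =
      k^-1 * - (2 * wx) - (N + 2 * (delta - 1) / k * p) by ring.
  have -> : - (c1 * N + c2 * p) = k^-1 * (s * N + lH * lM / s * p)
      - (N + 2 * (delta - 1) / k * p) by rewrite /c1 /c2; ring.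
  by rewrite lerD2r.
have step2 : c * (V1 + a * p) <= c1 * N + c2 * p.
  rewrite (@le_trans _ _ (c * (2 * q) + c * (b * p)))//.
    by rewrite -mulrDr (ler_pM2l c_gt0) /b; lra.
  apply: lerD.
    rewrite (@le_trans _ _ (c1 / (2 * lH) * (2 * q)))//.
      by rewrite ler_wpM2r ?mulr_ge0// ge_min lexx.
    have -> : c1 / (2 * lH) * (2 * q) = c1 * (q / lH).
      by field; rewrite gt_eqF.
    by rewrite (ler_pM2l c1_gt0) ler_pdivrMr// mulrC.
  rewrite mulrA ler_wpM2r// -ler_pdivlMr//.
  by rewrite ge_min lexx orbT.
by rewrite mulNr (le_trans step1)// lerN2.
Qed.

End Neutralization.

Theorem theorem2 (R : realType) (n : nat) (Bc Bd : 'M[R]_n)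
    (adj_Bc : adjacency_matrix Bc) (adj_Bd : adjacency_matrix Bd)
    (inconsistent : sign_inconsistent Bc Bd)
    (connected : strongly_connected (union_arc Bc Bd))
    (delta : R) (delta_gt1 : 1 < delta) (k : R) :
  let H := lyapunov_solution (laplacian Bc + laplacian Bd) in
  let M := laplacian Bc + delta *: laplacian Bd in
  let zeta := lambda_max H * lambda_max (M *m M^T) / (2 * (delta - 1)) in
  zeta < k ->
  achieves_neutralization
    (block_mx (- laplacian Bc) 1%:M
              (- (k *: laplacian Bd)) (- k%:M)).
Proof.
move=> H M zeta zeta_lt x0 y0 x y sol.
(* Sign-inconsistency exhibits an entry, so the dimension is positive. *)
have n_gt0 : (0 < n)%N.
  rewrite lt0n; apply/eqP => n0; apply: inconsistent => i.
  by exfalso; have := ltn_ord i; rewrite [X in (_ < X)%N]n0.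
have Lch := laplacian_sum_chained adj_Bc inconsistent connected.
have [Hpos HL] := lyapunov_solutionP Lch.
have [c c0 dec] := neutralization_decay Hpos HL n_gt0 delta_gt1 zeta_lt.
have [K K0 coer] := neutralization_coercive Hpos n_gt0 delta_gt1 zeta_lt.
have [Hsym _] := Hpos.
(* The matrix of V, local to its section, is read off from [dec]. *)
set P := (X in bform X) in dec coer.
have Psym : P^T = P.
  by rewrite linearD linearZ /= !trmx_mul !trmxK Hsym !mulmxA.
have decay t : 0 <= t -> sqnorm (x t) + sqnorm (y t) <=
    K * bform P (col_mx x0 y0) (col_mx x0 y0) * expR (- (c * t)).
  move=> t0; rewrite -sqnorm_col_mx (le_trans (coer _))// -mulrA.
  by rewrite ler_wpM2l ?(ltW K0)//; exact: lyapunov_decay sol _ t0.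
split; apply: (cvg_sqnorm0 c0) => t /decay; apply: le_trans.
- by rewrite lerDl sqnorm_ge0.
- by rewrite lerDr sqnorm_ge0.
Qed.
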